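(* Let $G$ be a directed graph, $r$ a vertex of $G$, and $T, T'$ two $r$-directed trees in $G$ with $|T|=|T'|=k$. Then there is a sequence $\langle T=T_0, T_1, \ldots, T_\ell=T'\rangle$ of $r$-directed trees in $G$ such that $|A(T_i)\setminus A(T_{i+1})| = |A(T_{i+1})\setminus A(T_i)|=1$ for all $0\le i<\ell$, and $\ell\le k$.
   Context: A directed tree is a directed graph whose underlying undirected graph is a tree and in which every vertex except one vertex $r$ has in-degree exactly $1$; $r$ is its root and the tree is called an $r$-directed tree. $|T|$ denotes the number of arcs of $T$. *)

(* Defs.v *)
From mathcomp Require Import all_boot.
From mathcomp Require Import finmap.

Set Implicit Arguments.
Unset Strict Implicit.
Unset Printing Implicit Defensive.

Local Open Scope fset_scope.

(* Loops, parallel arcs and infinitely many vertices or arcs are allowed;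
   simple digraphs are the case where (tail, head) is injective. *)
Record digraph := Digraph {
  vertex : choiceType;
  arc : choiceType;
  tail : arc -> vertex;
  head : arc -> vertex
}.

(* The data of a finite subgraph; closure under endpoints is [wf_sub].  The
   vertex set is kept because the tree with no arc still has its root. *)
Record sub (G : digraph) := Sub {
  verts : {fset vertex G};
  arcs : {fset arc G}
}.

Section Trees.
Variable G : digraph.
Implicit Types (H T : sub G) (e : arc G) (u v r : vertex G).

Definition wf_sub H : Prop :=
  forall e, e \in arcs H -> tail e \in verts H /\ head e \in verts H.

Definition joins e u v : bool :=
  ((tail e == u) && (head e == v)) || ((tail e == v) && (head e == u)).

(* A walk from [u] to [v] in the underlying undirected multigraph of [H]; each
   step (e, w) traverses [e], in either direction, to arrive at [w]. *)
Fixpoint walk H u (s : seq (arc G * vertex G)) v : bool :=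
  if s is (e, w) :: s' then [&& e \in arcs H, joins e u w & walk H w s' v]
  else u == v.

Definition connected H : Prop :=
  forall u v, u \in verts H -> v \in verts H -> exists s, walk H u s v.

(* The list of arrival vertices contains [u] once, as its last element.  A loop
   is a cycle of length 1 and two parallel or antiparallel arcs form a cycle of
   length 2. *)
Definition is_cycle H u (s : seq (arc G * vertex G)) : bool :=
  [&& walk H u s u, s != [::], uniq [seq x.1 | x <- s]
    & uniq [seq x.2 | x <- s]].

Definition acyclic H : Prop := forall u s, ~~ is_cycle H u s.

Definition underlying_tree H : Prop :=
  [/\ verts H != fset0, connected H & acyclic H].

Definition indeg H v : nat := #|` [fset e in arcs H | head e == v]|.

(* With the other clauses, [indeg T r != 1] forces [indeg T r = 0]. *)
Definition directed_tree r T : Prop :=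
  [/\ wf_sub T, underlying_tree T, r \in verts T
    & forall v, v \in verts T -> (indeg T v == 1) = (v != r)].

End Trees.

(* Main.v *)
(* Grow a subtree S rooted at r and contained in both the current tree A and the
   target B.  Take an arc e of B leaving the vertex set of S from within.  If e
   is in A, add it to S.  Otherwise exchange e in A against the arc of A with
   the same head or, if A has none, against a leaf arc outside S; no arc of S
   is lost, so S gains e.  Each exchange enlarges S, and |S| <= k.

   Acyclicity is handled through a rank of the vertices that increases along
   every arc.  After an exchange, a rank of the new tree is obtained from that
   of A by lifting all vertices outside S above the tail of e. *)
From Pilot Require Import Defs.
From mathcomp Require Import all_boot.
From mathcomp Require Import finmap.
(* Again, because seq.v and path.v also define [head] and [arc]. *)
Import Pilot.Defs.

Local Open Scope fset_scope.

Set Implicit Arguments.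
Unset Strict Implicit.

Section Arborescences.

Variables (G : digraph) (r : vertex G).
Implicit Types (H T : sub G) (A B C S : {fset arc G}) (e f g h : arc G).
Implicit Types (u v w : vertex G) (s : seq (arc G * vertex G)).

(** * Arborescences as sets of arcs *)

Notation head := (@head G).
Notation tail := (@tail G).

(* The vertex set of the subtree with arc set [A] is the root and the heads. *)
Definition spanned A v : Prop := v = r \/ exists2 h, h \in A & head h = v.

Definition ranked A : Prop :=
  exists d : vertex G -> nat, forall e, e \in A -> d (tail e) < d (head e).

(** Encodes an r-directed tree by its arcs alone. The rank stands in for undirected acyclicity and,
    by descent along parent arcs, also yields a path from [r] to every vertex. *)
Definition arborescence A : Prop :=
  [/\ {in A &, injective head},
      forall e, e \in A -> head e != r,
      forall e, e \in A -> spanned A (tail e)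
    & ranked A].

Definition sub_of_arcs A : sub G := Sub (r |` [fset head e | e in A]) A.

Lemma spannedS A B v : A `<=` B -> spanned A v -> spanned B v.
Proof.
move=> /fsubsetP sAB [->|[h hA <-]]; first by left.
by right; exists h => //; apply: sAB.
Qed.

Lemma sub_of_arcsP A v :
  reflect (spanned A v) (v \in verts (sub_of_arcs A)).
Proof.
rewrite /= in_fset1U; apply: (iffP orP).
- move=> [/eqP->|/imfsetP[h /= hA ->]]; first by left.
  by right; exists h.
- move=> [->|[h hA <-]]; first by left.
  by right; apply/imfsetP; exists h.
Qed.

(** * From directed trees to arborescences *)

(** Otherwise every arc of [C] has a predecessor in [C]. Iterating predecessors in a finite set must
    repeat an arc, which closes a directed cycle. *)
Lemma acyclic_source H C :
  acyclic H -> C `<=` arcs H -> C != fset0 ->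
  exists2 e, e \in C & forall f, f \in C -> head f != tail e.
Proof.
move=> acH /fsubsetP sCH /fset0Pn[e0 e0C].
case: (boolP (has (fun e => all (fun f => head f != tail e) C) C)).
  by case/hasP=> e eC /allP eP; exists e.
move/hasPn=> nosrc; exfalso.
(* A choice of predecessor; the default [e] is never reached for [e] in [C], so there [p e] depends
   only on [tail e]. *)
pose p e := seq.head e [seq f <- C | head f == tail e].
have pP e : e \in C -> p e \in C /\ head (p e) = tail e.
  move=> eC; have /allPn[f fC] := nosrc _ eC; rewrite negbK => /eqP hf.
  have: f \in [seq f <- C | head f == tail e] by rewrite mem_filter hf eqxx.
  rewrite /p; case E: [seq _ <- _ | _] => [//|g t] _ /=.
  have: g \in [seq f <- C | head f == tail e] by rewrite E mem_head.
  by rewrite mem_filter => /andP[/eqP].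
have p_eq e e' : e \in C -> e' \in C -> tail e = tail e' -> p e = p e'.
  move=> eC _ te; have := pP _ eC; rewrite /p -te.
  have /allPn[f fC] := nosrc _ eC; rewrite negbK => /eqP hf.
  have: f \in [seq f <- C | head f == tail e] by rewrite mem_filter hf eqxx.
  by case: [seq _ <- _ | _].
have iterC n e : e \in C -> iter n p e \in C.
  by elim: n => //= n IHn eC; have [] := pP _ (IHn eC).
have trajC n e : e \in C -> {subset traject p e n <= C}.
  by move=> eC f /trajectP[i _ ->]; apply: iterC.
have ex_loop : exists n, looping p e0 n.
  exists #|` C|; apply: contraT; rewrite -looping_uniq => /uniq_leq_size.
  move=> /(_ C (trajC _ _ e0C)); rewrite size_traject.
  by rewrite ltnn.
case: (ex_minnP ex_loop) => [[|n]] // loop_n min_n.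
have uniq_n : uniq (traject p e0 n.+1).
  by rewrite looping_uniq; apply/negP => /min_n; rewrite ltnn.
have /trajectP[i lt_in per_i] := loop_n.
pose m := n - i; pose e := iter i p e0.
have eC : e \in C by apply: iterC.
have per : iter m.+1 p e = e.
  by rewrite /e -iterD addSn subnK.
have uniq_m : uniq (traject p e m.+1).
  have En : n.+1 = (i + m.+1)%N by rewrite addnS subnKC.
  by move: uniq_n; rewrite En trajectD cat_uniq => /and3P[].
(* The cycle is traversed against its arcs, from [head e] back to itself. *)
pose s := [seq (f, tail f) | f <- traject p e m.+1].
apply: (negP (acH (head e) s)); rewrite /is_cycle; apply/and4P; split=> //.
- have walk_s n' g : g \in C ->
    walk H (head g) [seq (f, tail f) | f <- traject p g n'] (head (iter n' p g)).
    elim: n' g => [|n' IHn] g gC /=; first by rewrite eqxx.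
    have [pgC hpg] := pP _ gC.
    rewrite sCH //= /joins !eqxx orbT /= -hpg -iterS iterSr.
    exact: IHn.
  by have := walk_s m.+1 e eC; rewrite per.
- by rewrite -map_comp map_id_in.
(* Equal tails give equal predecessors, and [m] more applications of [p] return to [f] and [g], as
   [p] has period [m.+1] on the cycle. *)
- rewrite -map_comp map_inj_in_uniq //= => f g fT gT /= tfg.
  have fC := trajC m.+1 _ eC _ fT; have gC := trajC m.+1 _ eC _ gT.
  have /(@trajectP _ p e m.+1)[a _ Ef] := fT.
  have /(@trajectP _ p e m.+1)[b _ Eg] := gT.
  have Epq := p_eq _ _ fC gC tfg.
  have {Epq}: iter m p (p f) = iter m p (p g) by rewrite Epq.
  by rewrite -!iterSr Ef Eg -!iterD ![addn m.+1 _]addnC !iterD per.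
Qed.

(** Induction on the number of arcs: remove a source arc [e], put [tail e] at rank 0, and raise all
    other vertices by one. No arc enters [tail e], so every arc still increases the rank. *)
Lemma acyclic_ranked H : acyclic H -> ranked (arcs H).
Proof.
move=> acH.
suff rk n A : #|` A| = n -> A `<=` arcs H -> ranked A by exact: rk erefl _.
elim: n A => [|n IHn] A cA sAH.
  by exists (fun=> 0) => e; rewrite (cardfs0_eq cA) inE.
have /(acyclic_source acH sAH)[e eA src] : A != fset0.
  by rewrite -cardfs_gt0 cA.
have cAe : #|` A `\ e| = n by move: (cardfsD1 e A); rewrite eA cA => -[].
have [d dP] := IHn _ cAe (fsubset_trans (fsubD1set _ _) sAH).
exists (fun x => if x == tail e then 0 else (d x).+1) => g gA.
rewrite (negPf (src _ gA)); case: (altP eqP) => // ne_tail.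
rewrite ltnS; apply: dP; rewrite !inE gA andbT.
by apply: contra_neq ne_tail => ->.
Qed.

Lemma indeg_eq1P H v :
  reflect (exists e, [/\ e \in arcs H, head e = v &
                       forall f, f \in arcs H -> head f = v -> f = e])
          (indeg H v == 1).
Proof.
rewrite /indeg; apply: (iffP (cardfs1P _)).
- move=> [e E]; have: e \in [fset e] by rewrite inE.
  rewrite -E !inE /= => /andP[eH /eqP he]; exists e; split=> // f fH hf.
  by apply/eqP; rewrite -in_fset1 -E !inE /= fH hf eqxx.
- move=> [e [eH he uniq_e]]; exists e; apply/fsetP=> f; rewrite !inE /=.
  apply/andP/eqP=> [[fH /eqP hf]|->]; first exact: uniq_e.
  by rewrite he eqxx.
Qed.

Lemma directed_tree_arborescence T :
  directed_tree r T -> arborescence (arcs T) /\ T = sub_of_arcs (arcs T).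
Proof.
move=> [wfT [_ _ acT] rT indegT].
have par v : v \in verts T -> v != r ->
    exists e, [/\ e \in arcs T, head e = v &
                  forall f, f \in arcs T -> head f = v -> f = e].
  by move=> vT v_r; apply/indeg_eq1P; rewrite indegT.
have tailP e : e \in arcs T -> spanned (arcs T) (tail e).
  move=> eT; have [->|ne] := eqVneq (tail e) r; first by left.
  by right; have [f [fT hf _]] := par _ (wfT e eT).1 ne; exists f.
(* An arc into [r] would give every arc of [T] a predecessor, including those that leave [r], so
   there would be no source arc. *)
have no_r e : e \in arcs T -> head e != r.
  move=> eT; apply/eqP => he.
  have nz : arcs T != fset0 by apply/fset0Pn; exists e.
  have [f fT src] := acyclic_source acT (fsubset_refl _) nz.
  have [tf|[h hT hh]] := tailP f fT.
  - by have := src _ eT; rewrite he tf eqxx.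
  - by have := src _ hT; rewrite hh eqxx.
split.
  split=> //; last exact: acyclic_ranked.
  move=> e f eT fT Eh; have [g [_ _ ug]] := par _ (wfT e eT).2 (no_r _ eT).
  by rewrite (ug e) // (ug f).
case: T wfT rT {indegT acT tailP no_r} par => V A /= wfT rT par.
rewrite /sub_of_arcs; congr Sub; apply/fsetP => v.
apply/idP/(sub_of_arcsP A) => [vV|[->//|[e eA <-]]].
- have [->|ne] := eqVneq v r; first by left.
  by right; have [f [fT hf _]] := par _ vV ne; exists f.
- by have [] := wfT e eA.
Qed.

(** * Walks, and from arborescences back to directed trees *)

Lemma walk_cat H u s1 v s2 w :
  walk H u s1 v -> walk H v s2 w -> walk H u (s1 ++ s2) w.
Proof.
elim: s1 u => [|[e x] s1 IHs] u /=; first by move/eqP->.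
by move=> /and3P[-> -> /IHs IH] /IH ->.
Qed.

Section WalksInRankedGraphs.

Variables (H : sub G) (d : vertex G -> nat).
Hypothesis head_inj : {in arcs H &, injective head}.
Hypothesis dP : forall e, e \in arcs H -> d (tail e) < d (head e).

(* After entering a vertex through its unique incoming arc, a trail can only go
   on away from the root. *)
Lemma trail_descends e s v :
  e \in arcs H -> walk H (head e) s v -> uniq (e :: [seq x.1 | x <- s]) ->
  d (head e) <= d v /\ head (last e [seq x.1 | x <- s]) = v.
Proof.
elim: s e => [|[f w] s IHs] e eH; first by move=> /= /eqP<-.
rewrite [walk _ _ _ _]/= map_cons => /and3P[fH /orP[]/andP[/eqP t /eqP h] ws].
- move=> /= /andP[_ us]; rewrite -h in ws.
  have [le_d lst] := IHs f fH ws us; split=> //.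
  by apply: leq_trans le_d; rewrite -t ltnW ?dP.
- by rewrite /= inE -(head_inj fH eH h) eqxx.
Qed.

(** A forward step would force the trail, by [trail_descends], to enter [head e] through its unique
    incoming arc [e], which the trail avoids. So all steps go backwards and lower the rank. *)
Lemma trail_ascends e s w :
  e \in arcs H -> walk H w s (head e) -> uniq (e :: [seq x.1 | x <- s]) ->
  d (head e) <= d w.
Proof.
move=> eH; elim: s w => [|[f x] s IHs] w; first by move=> /= /eqP->.
rewrite [walk _ _ _ _]/= map_cons => /and3P[fH /orP[]/andP[/eqP t /eqP h] ws].
- move=> /= /andP[enotin us]; rewrite -h in ws.
  have [_ lst] := trail_descends fH ws us.
  have lastH : last f [seq y.1 | y <- s] \in arcs H.
    have allH u y : walk H u s y -> all (mem (arcs H)) [seq z.1 | z <- s].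
      by elim: (s) u => //= -[g z] s' IH u /= /and3P[-> _ /IH].
    have /allP sub := allH _ _ ws.
    have := mem_last f [seq y.1 | y <- s]; rewrite inE => /orP[/eqP->//|].
    by move/sub.
  by case/negP: enotin; rewrite -(head_inj lastH eH lst) mem_last.
- rewrite [uniq _]/= inE negb_or => /andP[/andP[_ enotin] /andP[_ us]].
  apply: leq_trans (IHs x ws _) _; first by rewrite /= enotin.
  by rewrite -t -h ltnW ?dP.
Qed.

(** If the first arc [e] of a cycle is taken forwards, the rest descends from [head e] to [tail e];
    if backwards, the rest leads from [tail e] to [head e] avoiding [e]. Both give
    [d (head e) <= d (tail e)]. *)
Lemma ranked_acyclic : acyclic H.
Proof.
move=> u [|[e w] s]; first by rewrite /is_cycle andbF.
apply/negP=> /and4P[/= /and3P[eH /orP[]/andP[/eqP t /eqP h] ws] _ us _].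
- rewrite -h in ws; have [le_d _] := trail_descends eH ws us.
  by have := dP eH; rewrite t ltnNge le_d.
- rewrite -h in ws; have := trail_ascends eH ws us.
  by rewrite -t leqNgt dP.
Qed.

End WalksInRankedGraphs.

Lemma arborescence_directed_tree A :
  arborescence A -> directed_tree r (sub_of_arcs A).
Proof.
move=> [injA no_r tailA [d dP]]; set T := sub_of_arcs A.
have rT : r \in verts T by apply/sub_of_arcsP; left.
have wfT : wf_sub T.
  move=> e eA; split; apply/sub_of_arcsP; first exact: tailA.
  by right; exists e.
(* Passing to the parent lowers the rank, so the induction ends at [r]. Walks in both directions are
   built together, which avoids reversing a walk. *)
have to_r v : v \in verts T ->
    exists s s', walk T v s r /\ walk T r s' v.
  have [n] := ubnP (d v); elim: n v => // n IHn v le_v vT.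
  have [->|[e eA he]] := sub_of_arcsP _ _ vT.
    by exists [::], [::]; rewrite /= eqxx.
  have [|s [s' [ws ws']]] := IHn (tail e) _ (wfT e eA).1.
    by rewrite -ltnS (leq_trans _ le_v) // ltnS -he dP.
  exists ((e, tail e) :: s), (s' ++ [:: (e, v)]); split.
    by rewrite /= eA ws /joins he !eqxx orbT.
  by apply: walk_cat ws' _; rewrite /= eA /joins he !eqxx.
split=> //.
  split; first by apply/fset0Pn; exists r.
  - move=> u v /to_r[s [_ [ws _]]] /to_r[_ [s' [_ ws']]].
    by exists (s ++ s'); apply: walk_cat ws ws'.
  - exact: (@ranked_acyclic T d).
move=> v vT; apply/indeg_eq1P/idP => [[e [eA <- _]]|v_r]; first exact: no_r.
have [v0|[e eA he]] := sub_of_arcsP _ _ vT; first by rewrite v0 eqxx in v_r.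
by exists e; split=> // f fA hf; apply: injA; rewrite // hf.
Qed.

(** * Exchanging one arc *)

Lemma card_exchange A e f :
  e \notin A -> f \in A ->
  [/\ A `\` (e |` (A `\ f)) = [fset f], (e |` (A `\ f)) `\` A = [fset e]
    & #|` e |` (A `\ f)| = #|` A|].
Proof.
move=> eA fA; have ef : e != f by apply: contraNneq eA => ->.
split.
- apply/fsetP=> g; rewrite !inE; have [->|gf] := eqVneq g f.
    by rewrite eq_sym (negPf ef) fA.
  by case: (g \in A); rewrite ?orbT ?andbF.
- apply/fsetP=> g; rewrite !inE; have [->|ge] := eqVneq g e.
    by rewrite eA.
  by case: (g \in A); rewrite ?andbF.
- by rewrite cardfsU1 !inE (negPf eA) andbF (cardfsD1 f A) fA.
Qed.

Lemma spanned_backward A S g :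
  arborescence A -> S `<=` A -> g \in A -> spanned S (head g) -> g \in S.
Proof.
move=> [injA no_r _ _] /fsubsetP sSA gA [hr|[h hS hh]].
  by have := no_r _ gA; rewrite hr eqxx.
by rewrite -(injA h g) // sSA.
Qed.

(** The last two hypotheses keep in-degrees right: only [f] may compete with [e] for its head, and
    if arcs leave [head f], then [e] replaces [f] as their parent. *)
Lemma arborescence_exchange A S e f :
  arborescence A -> S `<=` A ->
  (forall h, h \in S -> spanned S (tail h)) ->
  spanned S (tail e) -> ~ spanned S (head e) ->
  f \in A -> f \notin S ->
  (forall g, g \in A -> head g = head e -> g = f) ->
  (forall g, g \in A -> tail g = head f -> head f = head e) ->
  arborescence (e |` (A `\ f)).
Proof.
move=> arbA sSA clS te he fA fS par_e child_f.
have back := spanned_backward arbA sSA.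
have [injA no_r tailA [d dP]] := arbA.
have inP g : g \in e |` (A `\ f) -> g = e \/ g \in A /\ g <> f.
  by rewrite !inE => /orP[/eqP|/andP[/eqP gf gA]]; [left|right].
have sSA' : S `<=` e |` (A `\ f).
  apply/fsubsetP=> g gS; rewrite !inE (fsubsetP sSA _ gS) andbT.
  by apply/orP; right; apply: contraNneq fS => <-.
split.
- move=> g h /inP[->|[gA gf]] /inP[->|[hA hf]] // Eh; last exact: injA.
  + by case: hf; apply: par_e.
  + by case: gf; apply: par_e.
- move=> g /inP[->|[gA _]]; last exact: no_r.
  by apply/eqP=> her; apply: he; left.
- move=> g /inP[->|[gA gf]]; first exact: spannedS sSA' te.
  have [->|[h hA hh]] := tailA g gA; [by left|right].
  have [Ehf|hf] := eqVneq h f.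
    exists e; first by rewrite !inE eqxx.
    by rewrite -(child_f g) ?Ehf -?hh ?Ehf.
  by exists h; rewrite // !inE hf hA orbT.
- pose V := verts (sub_of_arcs S).
  (* The shift puts [head e], outside [V], above [tail e]. Arcs of [A] cannot enter [V] from
     outside: such an arc lies in [S] by [back], hence has its tail in [V]. *)
  exists (fun x => if x \in V then d x else (d x + (d (tail e)).+1)%N) => g.
  move=> /inP[->|[gA gf]].
    rewrite (introT (sub_of_arcsP S _) te) (introF (sub_of_arcsP S _) he).
    by rewrite addnS ltnS leq_addl.
  have lt_d := dP g gA; case: ifPn => [_|tV].
    by case: ifP => // _; apply: leq_trans lt_d _; rewrite leq_addr.
  case: ifPn => [/sub_of_arcsP /(back g gA) gS|_]; last by rewrite ltn_add2r.
  by case/negP: tV; apply/sub_of_arcsP/clS.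
Qed.

(* If [e] reaches a new vertex, the arc given up is one into a leaf outside [S];
   otherwise it is the arc of [A] with the same head as [e]. *)
Lemma exchange_arc A S e :
  arborescence A -> S `<=` A -> S != A ->
  (forall h, h \in S -> spanned S (tail h)) ->
  spanned S (tail e) -> ~ spanned S (head e) ->
  exists f, [/\ f \in A, f \notin S & arborescence (e |` (A `\ f))].
Proof.
move=> arbA sSA neSA clS te he.
have back := spanned_backward arbA sSA.
have [injA no_r tailA [d dP]] := arbA.
have exch := arborescence_exchange (e := e) arbA sSA clS te he.
have [/hasP[f fA /eqP hf]|/hasPn noe] := boolP (has (fun f => head f == head e) A).
  have fS : f \notin S by apply/negP=> fS; apply: he; right; exists f.
  by exists f; split=> //; apply: exch => // g gA hg; apply: injA; rewrite ?hg.
have [f0 f0D] : exists f, f \in A `\` S.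
  apply/fset0Pn; rewrite fsetD_eq0; apply: contra neSA => sAS.
  by rewrite eqEfsubset sSA.
(* Take [f] outside [S] with head of maximal rank. An arc [g] leaving [head f] would also be outside
   [S], since otherwise [f] would enter a vertex of [S]; its head would then outrank that of [f]. *)
pose P (x : A `\` S) := true; pose x0 := [` f0D].
case: (@arg_maxnP _ x0 P (fun x => d (head (val x))) isT) => x _ maxx.
have := fsvalP x; set f := fsval x in maxx *; rewrite inE => /andP[fS fA].
exists f; split=> //; apply: exch => // g gA hg.
  by have := noe _ gA; rewrite hg eqxx.
have gS : g \notin S.
  by apply: contra fS => gS; apply: back; rewrite -?hg //; apply: clS.
have gD : g \in A `\` S by rewrite inE gS.
have := maxx [` gD] isT; rewrite /= => le_d.
by have := dP g gA; rewrite hg ltnNge le_d.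
Qed.

(** Among the arcs of [B] outside [S], one whose head has minimal rank works: the parent arc of its
    tail has a head of smaller rank, so it is in [S]. *)
Lemma next_arc B S :
  arborescence B -> S `<=` B -> S != B ->
  exists e, [/\ e \in B, spanned S (tail e) & ~ spanned S (head e)].
Proof.
move=> [injB no_r tailB [d dP]] sSB neSB.
have [f0 f0D] : exists f, f \in B `\` S.
  apply/fset0Pn; rewrite fsetD_eq0; apply: contra neSB => sBS.
  by rewrite eqEfsubset sSB.
pose P (x : B `\` S) := true; pose x0 := [` f0D].
case: (@arg_minnP _ x0 P (fun x => d (head (val x))) isT) => x _ minx.
have := fsvalP x; set e := fsval x in minx *; rewrite inE => /andP[eS eB].
exists e; split=> //.
- have [->|[h hB hh]] := tailB e eB; [by left|right; exists h => //].
  apply: contraT => hS; have hD : h \in B `\` S by rewrite inE hS.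
  have := minx [` hD] isT; rewrite /= hh => le_d.
  by have := dP e eB; rewrite ltnNge le_d.
- case=> [her|[h hS hh]]; first by have := no_r _ eB; rewrite her eqxx.
  by case/negP: eS; rewrite -(injB h e) // (fsubsetP sSB).
Qed.

(** * The sequence of exchanges *)

(** Induction on the number of arcs of [A] outside the common subtree [S]. Each round adds an arc to
    [S] and uses at most one exchange, which gives the bound on [l]. *)
Lemma arborescence_reconfiguration A B S :
  arborescence A -> arborescence B -> #|` A| = #|` B| ->
  S `<=` A -> S `<=` B -> (forall h, h \in S -> spanned S (tail h)) ->
  exists (l : nat) (As : nat -> {fset arc G}),
    [/\ As 0 = A, As l = B,
        forall i, i <= l -> arborescence (As i),
        forall i, i < l ->
          #|` As i `\` As i.+1| = 1 /\ #|` As i.+1 `\` As i| = 1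
      & (l + #|` S| <= #|` A|)%N].
Proof.
have [n] := ubnP (#|` A| - #|` S|).
elim: n A S => // n IHn A S; rewrite ltnS => le_n arbA arbB cAB sSA sSB clS.
have cSA := fsubset_leq_card sSA.
have [AB|neAB] := eqVneq A B.
  by exists 0, (fun=> A); split.
(* By equal cardinalities, [S] filling [A] would also fill [B], making [A] and [B] equal. *)
have lt_SA : #|` S| < #|` A|.
  rewrite ltn_neqAle cSA andbT; apply: contra neAB => /eqP cS.
  have /eqP <- : S == A by rewrite eqEfcard sSA cS leqnn.
  by rewrite eqEfcard sSB cS cAB leqnn.
have neSA : S != A by apply: contraTneq lt_SA => ->; rewrite ltnn.
have neSB : S != B by apply: contraTneq lt_SA => ->; rewrite cAB ltnn.
have [e [eB te he]] := next_arc arbB sSB neSB.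
have eS : e \notin S by apply/negP=> eS; apply: he; right; exists e.
have sS' : S `<=` e |` S by rewrite fsubsetU1.
have cS' : #|` e |` S| = #|` S|.+1 by rewrite cardfsU1 eS.
have clS' h : h \in e |` S -> spanned (e |` S) (tail h).
  by rewrite in_fset1U => /orP[/eqP->|/clS]; apply: (spannedS sS').
have sS'B : e |` S `<=` B by rewrite fsubUset fsub1set eB.
have lt_n A' : #|` A'| = #|` A| -> #|` A'| - #|` e |` S| < n.
  by move=> ->; rewrite cS' subnS prednK ?subn_gt0.
(* If [e] is already in [A], only [S] grows and the sequence gets no new term. *)
have [eA|eA] := boolP (e \in A).
  have sS'A : e |` S `<=` A by rewrite fsubUset fsub1set eA.
  have [l [As [As0 Asl arbAs stepAs le_l]]] :=
    IHn A (e |` S) (lt_n _ erefl) arbA arbB cAB sS'A sS'B clS'.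
  exists l, As; split=> //.
  by apply: leq_trans le_l; rewrite leq_add2l cS'.
have [f [fA fS arbA']] := exchange_arc arbA sSA neSA clS te he.
have [D1 D2 cA'] := card_exchange eA fA.
have sS'A' : e |` S `<=` e |` (A `\ f).
  rewrite fsetUS //; apply/fsubsetP=> g gS; rewrite !inE (fsubsetP sSA _ gS).
  by rewrite andbT; apply: contraNneq fS => <-.
have [l [As [As0 Asl arbAs stepAs le_l]]] :=
  IHn _ (e |` S) (lt_n _ cA') arbA' arbB (etrans cA' cAB) sS'A' sS'B clS'.
exists l.+1, (fun i => if i is j.+1 then As j else A); split=> //.
- by case.
- by case=> [_|i]; [rewrite As0 D1 D2 !cardfs1|apply: stepAs].
- by rewrite -cA' (leq_trans _ le_l) // cS' addSnnS.
Qed.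

End Arborescences.

Unset Implicit Arguments.
Set Strict Implicit.

Theorem theorem5 (G : digraph) (r : vertex G) (T T' : sub G) (k : nat)
    (hT : directed_tree r T) (hT' : directed_tree r T')
    (hk : #|` arcs T| = k) (hk' : #|` arcs T'| = k) :
  exists (l : nat) (Ts : nat -> sub G),
    [/\ Ts 0 = T, Ts l = T',
        forall i : nat, i <= l -> directed_tree r (Ts i),
        forall i : nat, i < l ->
          #|` arcs (Ts i) `\` arcs (Ts i.+1)| = 1 /\
          #|` arcs (Ts i.+1) `\` arcs (Ts i)| = 1
      & l <= k].
Proof.
have [arbT ET] := directed_tree_arborescence hT.
have [arbT' ET'] := directed_tree_arborescence hT'.
(* The common subtree starts with no arcs, that is, as the root alone. *)
have [//|l [As [As0 Asl arbAs stepAs le_l]]] :=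
  arborescence_reconfiguration arbT arbT' (etrans hk (esym hk'))
    (fsub0set _) (fsub0set _).
exists l, (fun i => sub_of_arcs r (As i)); split=> //.
- by rewrite As0 -ET.
- by rewrite Asl -ET'.
- by move=> i /arbAs; apply: arborescence_directed_tree.
- by rewrite -hk (leq_trans _ le_l) ?leq_addr.
Qed.
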